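(* Let $X,Y$ be Hilbert spaces and let $F\colon X\to Y$ be a bounded linear operator. Let $\mathcal R=\psi\circ\Phi\colon X\to[0,\infty]$ be a network regularizer of the form described in the context, let $y\in Y$, and let $x_+$ be an $\mathcal R$-minimizing solution of $F(x)=y$. Assume that $\mathcal R$ is Gâteaux differentiable, that $\mathcal R'(x_+)\in\operatorname{Ran}(F^* )$, and that there exist positive constants $\gamma,\varepsilon$ with $$\mathcal R(x_+)-\mathcal R(x)\le\gamma\|F(x)-F(x_+)\|$$ for all $x\in X$ satisfying $|\mathcal R(x)-\mathcal R(x_+)|<\varepsilon$. Then there is a constant $C>0$ such that for all such $x$ $$\mathcal B_{\mathcal R}(x,x_+)\le\mathcal R(x)-\mathcal R(x_+)+C\|F(x)-F(x_+)\|.$$ In particular, for the similarity measure $\mathcal D(z,y)=\|z-y\|^2$, if conditions (A1), (A2), (A3) of the context are satisfied (with $\tau\ge1$ the constant from (A2)), then with $\varphi(t):=C\sqrt t$, $\varphi^{-*}(s):=\sup\{st-t^2/C^2\mid t\ge0\}$, $\mathcal T_{\alpha;y_\delta}(x)=\|F(x)-y_\delta\|^2+\alpha\mathcal R(x)$, and $y_\delta\in Y$, $\delta>0$ satisfying $\|y-y_\delta\|^2\le\delta$, the following hold: (a) For sufficiently small $\alpha>0$ and $\delta>0$, every $x_{\alpha,\delta}\in\arg\min\mathcal T_{\alpha;y_\delta}$ satisfies $$\mathcal B_{\mathcal R}(x_{\alpha,\delta},x_+)\le\frac{\delta}{\alpha}+\varphi(\tau\delta)+\frac{\varphi^{-*}(\tau\alpha)}{\tau\alpha}.$$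 (b) If $\alpha\sim\delta/\varphi(\tau\delta)$, then $\mathcal B_{\mathcal R}(x_{\alpha,\delta},x_+)=\mathcal O(\varphi(\tau\delta))$ as $\delta\to0$.
   Context: An $\mathcal R$-minimizing solution of $F(x)=y$ is any element of $\arg\min\{\mathcal R(x)\mid x\in X,\ F(x)=y\}$. The absolute Bregman distance is $\mathcal B_{\mathcal R}(x,x_+):=|\mathcal R(x)-\mathcal R(x_+)-\mathcal R'(x_+)(x-x_+)|$, where $\mathcal R'(x_+)$ is the Gâteaux derivative, identified with an element of $X$. $F^*\colon Y\to X$ is the adjoint of $F$. The notation $\alpha\sim g(\delta)$ means that $\alpha=\alpha(\delta)$ is chosen of the same order as $g(\delta)$ as $\delta\to0$ (bounded above and below by positive constant multiples of $g(\delta)$). Network regularizer: $\mathcal R(x)=\psi(\Phi(x))$ with $\Phi=\sigma_L\circ\mathbb V_L\circ\cdots\circ\sigma_1\circ\mathbb V_1$, where $\mathbb X_0=X$, $\mathbb X_{\ell-1/2}$ and $\mathbb X_\ell$ ($\ell=1,\dots,L$) are Banach spaces, $\mathbb V_\ell\colon\mathbb X_{\ell-1}\to\mathbb X_{\ell-1/2}$, $\mathbb V_\ell(x)=\mathbb A_\ell x+b_\ell$ are affine, $\sigma_\ell\colon\mathbb X_{\ell-1/2}\to\mathbb X_\ell$ are possibly non-linear, and $\psi\colon\mathbb X_L\to[0,\infty]$. Conditions: (A1) $\mathcal R=\psi\circ\sigma_L\circ\mathbb V_L\circ\cdots\circ\sigma_1\circ\mathbb V_1$ with affine operators $\mathbb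 V_\ell(x)=\mathbb A_\ell x+b_\ell$, $\mathbb A_\ell$ are bounded linear, $\sigma_\ell$ are weakly continuous, and $\psi$ is weakly lower semi-continuous. (A2) There is $\tau\ge1$ with $\mathcal D(y_0,y_1)\le\tau\mathcal D(y_0,y_2)+\tau\mathcal D(y_2,y_1)$ for all $y_0,y_1,y_2\in Y$; $\mathcal D(y_0,y_1)=0\iff y_0=y_1$; if $y_k\to y$ in $Y$ then $\mathcal D(y_k,y)\to0$; $(x,y)\mapsto\mathcal D(F(x),y)$ is sequentially lower semi-continuous (weak topology on $X$, norm topology on $Y$). (A3) $\mathcal R(x)\to\infty$ as $\|x\|\to\infty$. *)

(* Defs.v *)
From HB Require Import structures.
From mathcomp Require Import all_boot all_order all_algebra.
From mathcomp Require Import all_classical all_reals all_analysis.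

Set Implicit Arguments.
Unset Strict Implicit.
Unset Printing Implicit Defensive.

Import Order.TTheory GRing.Theory Num.Theory.
Import numFieldNormedType.Exports.

Local Open Scope classical_set_scope.
Local Open Scope ring_scope.
Local Open Scope ereal_scope.

(* Real Hilbert spaces: Banach spaces whose norm comes from an inner product. *)
HB.mixin Record NormedModule_isHilbert (R : realType) X
    & CompleteNormedModule R X := {
  inner : {dot X for (@idfun R)} ;
  inner_normE : forall x : X, inner x x = (`|x| ^+ 2)%R
}.

#[short(type="hilbertType")]
HB.structure Definition Hilbert (R : realType) :=
  {X of CompleteNormedModule R X & NormedModule_isHilbert R X}.

Definition adjoint (R : realType) (X Y : hilbertType R)
    (F : X -> Y) (Fadj : Y -> X) :=
  forall x y, inner (F x) y = inner x (Fadj y).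

(* [weak X] is [X] with the coarsest topology that makes every bounded linear
   functional continuous. *)
Definition dual (R : realType) (X : normedModType R) :=
  {f : {linear X -> R^o} | continuous f}.

Definition weak (R : realType) (X : normedModType R) : Type :=
  sup_topology
    (fun f : dual X => Topological.class (initial_topology (sval f : X -> R^o))).

HB.instance Definition _ (R : realType) (X : normedModType R) :=
  Topological.copy (weak X) (sup_topology
    (fun f : dual X => Topological.class (initial_topology (sval f : X -> R^o)))).

Section network.
Context {R : realType}.

(* The spaces XX_0 = X, XX_1 = S 0, XX_2 = S 1, and so on. *)
Definition layer_space (X : completeNormedModType R)
    (S : nat -> completeNormedModType R) (l : nat) : completeNormedModType R :=
  if l is k.+1 then S k else X.

(* With 0-based layers l = 0, ..., depth - 1, [hidden l] is XX_(l+1),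
   [half l] is XX_(l+1/2), and [weight l], [bias l], [act l] are A_(l+1),
   b_(l+1), sigma_(l+1).  The data at indices l >= depth are never used. *)
Record network (X : completeNormedModType R) := Network {
  depth : nat ;
  depth_gt0 : (0 < depth)%N ;
  hidden : nat -> completeNormedModType R ;
  half : nat -> completeNormedModType R ;
  weight : forall l, {linear layer_space X hidden l -> half l} ;
  bias : forall l, half l ;
  act : forall l, half l -> hidden l ;
  psi : layer_space X hidden depth -> \bar R ;
  psi_ge0 : forall z, 0 <= psi z
}.

Variables (X : completeNormedModType R) (N : network X).

Fixpoint feature (l : nat) : X -> layer_space X (hidden N) l :=
  if l is k.+1 then
    fun x => act (weight N k (feature k x) + bias N k)%R
  else id.

Definition regularizer (x : X) : \bar R := psi (feature (depth N) x).

Definition conditionA1 :=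
  [/\ forall l, (l < depth N)%N -> bounded_near (weight N l) (nbhs 0%R),
      forall l, (l < depth N)%N ->
        continuous (@act X N l : weak (half N l) -> weak (hidden N l)) &
      lower_semicontinuous
        (@psi X N : weak (layer_space X (hidden N) (depth N)) -> \bar R)].

End network.

Definition conditionA2 (R : realType) (X Y : normedModType R) (F : X -> Y)
    (D : Y -> Y -> \bar R) (tau : R) :=
  [/\ (1 <= tau)%R,
      forall y0 y1 y2, D y0 y1 <= tau%:E * D y0 y2 + tau%:E * D y2 y1,
      forall y0 y1, D y0 y1 = 0 <-> y0 = y1,
      forall (y_ : nat -> Y) (y : Y), y_ k @[k --> \oo] --> y ->
        D (y_ k) y @[k --> \oo] --> 0 &
      forall (x_ : nat -> weak X) (x : weak X) (y_ : nat -> Y) (y : Y),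
        x_ k @[k --> \oo] --> x -> y_ k @[k --> \oo] --> y ->
        D (F x) y <= limn_einf (fun k => D (F (x_ k)) (y_ k))].

Definition conditionA3 (R : realType) (X : normedModType R) (Rf : X -> \bar R) :=
  forall M : R, exists r : R, forall x : X, (r < `|x|)%R -> M%:E < Rf x.

Definition argmin (R : realType) (T : Type) (A : set T) (f : T -> \bar R) : set T :=
  [set x | A x /\ forall z, A z -> f x <= f z].

Definition minimizing_solution (R : realType) (X Y : Type) (F : X -> Y)
    (Rf : X -> \bar R) (y : Y) : set X :=
  argmin [set x | F x = y] Rf.

(* The finiteness clause makes [fine] harmless: the difference quotients only
   involve values of [Rf] that are finite. *)
Definition gateaux_derivative (R : realType) (X : normedModType R)
    (Rf : X -> \bar R) (x : X) (l : dual X) :=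
  forall h : X,
    (\forall t \near (0%R : R), Rf (x + t *: h)%R \is a fin_num) /\
    is_derive x h (fun z => fine (Rf z) : R^o) (sval l h).

Definition gateaux_differentiable (R : realType) (X : normedModType R)
    (Rf : X -> \bar R) :=
  forall x, exists l, gateaux_derivative Rf x l.

(* [g] is the element of X identified with the Gateaux derivative of [Rf] at
   [x]; it is unique. *)
Definition gateaux_gradient (R : realType) (X : hilbertType R)
    (Rf : X -> \bar R) (x g : X) :=
  exists2 l, gateaux_derivative Rf x l & forall h, sval l h = inner g h.

(* [g] is meant to be the gradient of [Rf] at [xp]. *)
Definition bregman (R : realType) (X : hilbertType R)
    (Rf : X -> \bar R) (g x xp : X) : \bar R :=
  `|Rf x - Rf xp - (inner g (x - xp)%R)%:E|.

Definition sqdist (R : realType) (Y : normedModType R) (z y : Y) : \bar R :=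
  (`|z - y| ^+ 2)%:E.

Definition tikhonov (R : realType) (X Y : normedModType R) (F : X -> Y)
    (Rf : X -> \bar R) (alpha : R) (yd : Y) (x : X) : \bar R :=
  (`|F x - yd| ^+ 2)%:E + alpha%:E * Rf x.

Definition phi (R : realType) (C t : R) : R := (C * Num.sqrt t)%R.

(* For C > 0 the set is nonempty and bounded above, so this is its least upper
   bound. *)
Definition phi_conj (R : realType) (C s : R) : R :=
  sup [set (s * t - t ^+ 2 / C ^+ 2)%R | t in [set t : R | (0 <= t)%R]].

(* f(delta) ~ g(delta) as delta tends to 0 from above. *)
Definition same_order (R : realType) (f g : R -> R) :=
  exists c1 c2 : R, [/\ (0 < c1)%R, (0 < c2)%R &
    \forall d \near (0%R : R)^'+, (c1 * g d <= f d <= c2 * g d)%R].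

(* Main.v *)
Require Import Defs.
From mathcomp Require Import all_boot all_order all_algebra.
From mathcomp Require Import all_classical all_reals all_analysis.
From mathcomp Require Import ring lra.

(** Write g = F^* w.  Then |<g, x - x_+>| <= |w| |F x - F x_+|, so the Bregman
    bound with C = 2 gamma + |w| holds as soon as
    R(x_+) - R(x) <= gamma |F x - F x_+|, in particular whenever
    R(x) >= R(x_+), without any restriction on the size of R(x) - R(x_+).
    For Tikhonov minimizers it therefore suffices to exclude
    R(x) <= R(x_+) - eps.  This sublevel set is bounded and weakly closed and
    misses the fibre F x = y; as balls are weakly compact, the residual
    |F x - y| is bounded below on it, whereas minimizers have a small residual
    when alpha and delta are small.  Hence no coupling between alpha and delta
    is needed in the rate (a), which follows from Young's inequality. *)

Import Order.TTheory GRing.Theory Num.Theory.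
Import numFieldNormedType.Exports.

Local Open Scope classical_set_scope.
Local Open Scope ring_scope.

(** * Inner products, Cauchy-Schwarz and Riesz representation *)

Section inner.
Context {R : realType} {X : hilbertType R}.
Implicit Types (x y z : X) (a : R).

Lemma innerC x y : inner x y = inner y x.
Proof. by rewrite hermC expr0 mul1r. Qed.

Lemma innerDl x y z : inner (x + y) z = inner x z + inner y z.
Proof. exact: linearDl. Qed.

Lemma innerZl a x z : inner (a *: x) z = a * inner x z.
Proof. exact: linearZl_LR. Qed.

Lemma innerDr x y z : inner z (x + y) = inner z x + inner z y.
Proof. by rewrite innerC innerDl !(innerC _ z). Qed.

Lemma innerZr a x z : inner z (a *: x) = a * inner z x.
Proof. by rewrite innerC innerZl innerC. Qed.

Lemma inner0r z : inner z 0 = 0.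
Proof. by rewrite -(scale0r 0) innerZr mul0r. Qed.

Lemma innerNl x z : inner (- x) z = - inner x z.
Proof. by rewrite -scaleN1r innerZl mulN1r. Qed.

Lemma normD_sqr x y : `|x + y| ^+ 2 = `|x| ^+ 2 + 2 * inner x y + `|y| ^+ 2.
Proof.
by rewrite -!inner_normE innerDl !innerDr (innerC y x); ring.
Qed.

Lemma Cauchy_Schwarz x y : `|inner x y| <= `|x| * `|y|.
Proof.
have quad t : 0 <= `|x| ^+ 2 + 2 * t * inner x y + t ^+ 2 * `|y| ^+ 2.
  have -> : `|x| ^+ 2 + 2 * t * inner x y + t ^+ 2 * `|y| ^+ 2
      = `|x + t *: y| ^+ 2.
    by rewrite normD_sqr innerZr normrZ exprMn real_normK ?num_real//; ring.
  exact: sqr_ge0.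
rewrite -(@ler_pXn2r _ 2)// ?nnegrE ?mulr_ge0// real_normK ?num_real// exprMn.
have [y0|yn0] := eqVneq `|y| 0.
  have -> : inner x y = 0.
    by move/normr0_eq0: y0 => ->; rewrite inner0r.
  by rewrite expr0n mulr_ge0 ?sqr_ge0.
have y2 : 0 < `|y| ^+ 2 by rewrite exprn_gt0// lt_def yn0 normr_ge0.
(* This [t] minimizes the quadratic [|x + t *: y| ^+ 2]. *)
have := quad (- inner x y / `|y| ^+ 2).
rewrite -(pmulr_lge0 _ y2).
have -> : (`|x| ^+ 2 + 2 * (- inner x y / `|y| ^+ 2) * inner x y +
   (- inner x y / `|y| ^+ 2) ^+ 2 * `|y| ^+ 2) * `|y| ^+ 2
   = `|x| ^+ 2 * `|y| ^+ 2 - inner x y ^+ 2 by field.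
by rewrite subr_ge0.
Qed.

(* Near-minimizers of [|v|^2 - 2 l v] represent [l] up to a small error, and
   such approximate representatives form a Cauchy filter. *)
Lemma Riesz_representation (l : X -> R) (r : R) : linear_for *%R l ->
  (forall v, `|l v| <= r * `|v|) -> exists x, forall v, l v = inner x v.
Proof.
move=> l_lin l_bnd.
pose J v := `|v| ^+ 2 - 2 * l v.
have J_ge v : - r ^+ 2 <= J v.
  have := l_bnd v; rewrite ler_norml => /andP[_ lv].
  have := sqr_ge0 (`|v| - r); rewrite /J; nra.
pose S e := [set v : X | forall h, `|inner v h - l h| <= e * `|h|].
have S_neq0 e : 0 < e -> S e !=set0.
  move=> e0.
  have J_inf : has_inf (range J).
    by split; [exists (J 0), 0|exists (- r ^+ 2) => _ [v _ <-]].
  have e20 : 0 < e ^+ 2 by rewrite exprn_gt0.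
  (* Moving [v] by [t *: h] changes [J] by [2 * t * d + t ^+ 2 * |h| ^+ 2] and can lower it by at
     most [e ^+ 2]. At the best [t] this says [d ^+ 2 <= e ^+ 2 * |h| ^+ 2]. *)
  have [_ [v _ <-] Jv] := inf_adherent e20 J_inf.
  exists v => h; set d := inner v h - l h.
  have quad t : 0 <= e ^+ 2 + 2 * t * d + t ^+ 2 * `|h| ^+ 2.
    have : inf (range J) <= J (t *: h + v).
      by apply: ge_inf; [exact: (proj2 J_inf)|exists (t *: h + v)].
    rewrite /J l_lin (addrC (t *: h)) normD_sqr innerZr normrZ exprMn.
    rewrite real_normK ?num_real// => infJ.
    by move: Jv; rewrite /J /d; lra.
  rewrite -(@ler_pXn2r _ 2)// ?nnegrE ?mulr_ge0// ?(ltW e0)//.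
  rewrite real_normK ?num_real// exprMn.
  have [h0|hn0] := eqVneq `|h| 0.
    move/normr0_eq0: h0 => h0; suff -> : d = 0.
      by rewrite expr0n mulr_ge0 ?sqr_ge0.
    rewrite /d h0; have := l_bnd 0; rewrite normr0 mulr0 normr_le0 => /eqP ->.
    by rewrite inner0r subr0.
  have h2 : 0 < `|h| ^+ 2 by rewrite exprn_gt0// lt_def hn0 normr_ge0.
  have := quad (- d / `|h| ^+ 2); rewrite -(pmulr_lge0 _ h2).
  have -> : (e ^+ 2 + 2 * (- d / `|h| ^+ 2) * d +
     (- d / `|h| ^+ 2) ^+ 2 * `|h| ^+ 2) * `|h| ^+ 2
     = e ^+ 2 * `|h| ^+ 2 - d ^+ 2 by field.
  by rewrite subr_ge0.
pose G := filter_from [set e : R | 0 < e] S.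
have S_le e e' : e <= e' -> S e `<=` S e'.
  by move=> ee' v Sv h; rewrite (le_trans (Sv h))// ler_wpM2r.
have GF : ProperFilter G.
  apply: filter_from_proper => [|e /S_neq0//].
  apply: filter_from_filter; first by exists 1; rewrite /= ltr01.
  move=> i j i0 j0; exists (Num.min i j); first by rewrite /= lt_min i0.
  by move=> v Sv; split; apply: S_le Sv; rewrite ge_min lexx ?orbT.
(* Both defining inequalities are tested on [h = u - v]. *)
have S_close e u v : 0 <= e -> S e u -> S e v -> `|u - v| <= 2 * e.
  move=> e0 Su Sv; have [->|uv0] := eqVneq `|u - v| 0.
    by rewrite mulr_ge0.
  have uv_gt0 : 0 < `|u - v| by rewrite lt_def uv0 normr_ge0.
  rewrite -(ler_pM2r uv_gt0) -expr2 -inner_normE innerDl innerNl.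
  have := Su (u - v); have := Sv (u - v); rewrite !ler_norml.
  by move=> /andP[? _] /andP[_ ?]; lra.
have /cauchy_cvg Gx : cauchy G.
  apply: cauchy_exP => e e0.
  have e40 : 0 < e / 4 by rewrite divr_gt0.
  have [u Su] := S_neq0 _ e40.
  exists u, (e / 4) => // v Sv; rewrite -ball_normE /=.
  by rewrite (le_lt_trans (S_close _ _ _ (ltW e40) Su Sv))//; lra.
have limG : id x @[x --> G] --> lim G by [].
exists (lim G) => h; apply/eqP; rewrite -subr_eq0 -normr_le0.
apply/ler_addgt0Pl => e e0; rewrite addr0.
(* Two errors, from the limit and from the approximate representation, get [e / 2] each; adding 1
   avoids dividing by zero when [h = 0]. *)
have k0 : 0 < e / 2 / (`|h| + 1) by rewrite !divr_gt0// ltr_wpDl.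
near G => v.
have Sv : S (e / 2 / (`|h| + 1)) v by near: v; exists (e / 2 / (`|h| + 1)).
have limv : `|lim G - v| < e / 2 / (`|h| + 1).
  by near: v; move/cvgrPdist_lt : limG; exact.
have -> : l h - inner (lim G) h = - inner (lim G - v) h - (inner v h - l h).
  by rewrite innerDl innerNl; ring.
rewrite (le_trans (ler_normB _ _))// normrN.
have := Cauchy_Schwarz (lim G - v) h; have := Sv h.
have : e / 2 / (`|h| + 1) * `|h| <= e / 2.
  by rewrite mulrAC ler_pdivrMr ?ltr_wpDl// ler_wpM2l ?ltW ?divr_gt0// ltrDl.
have := ler_wpM2r (normr_ge0 h) (ltW limv).
by lra.
Unshelve. all: by end_near. Qed.

End inner.

(** * Weak convergence and continuity, tested on bounded functionals *)

Lemma cvg_weakP (R : realType) (X : normedModType R) (G : set_system X)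
    (x : X) : Filter G ->
  G --> (x : weak X) <->
  forall f : dual X, sval f z @[z --> G] --> (sval f x : R^o).
Proof.
move=> GF; split=> [/cvg_sup Gx f|Gx].
  apply: (cvg_comp _ _ (Gx f)).
  exact: (@initial_continuous _ _ (sval f : X -> R^o)).
apply/cvg_sup => f A.
rewrite (@nbhsE (initial_topology (sval f : X -> R^o))).
move=> -[_ [[B oB <-] Bx] BA].
apply: filterS BA _; apply: (Gx f); exact: open_nbhs_nbhs.
Qed.

Lemma dual_weak_continuous (R : realType) (X : normedModType R) (f : dual X) :
  continuous (sval f : weak X -> R^o).
Proof.
move=> x.
exact: (cvg_weakP _ _ _ _ (nbhs_filter (x : weak X))).1 (fun A => id) f.
Qed.

Lemma continuous_weakP (R : realType) (X Z : normedModType R) (h : X -> Z) :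
  continuous (h : weak X -> weak Z) <->
  forall f : dual Z, continuous (sval f \o h : weak X -> R^o).
Proof.
have hF x := fmap_filter h (nbhs_filter (x : weak X)).
split=> h_cont => [f x|x].
  exact: ((cvg_weakP _ _ _ _ (hF x)).1 (h_cont x) f).
by apply/(cvg_weakP _ _ _ _ (hF x)) => f; exact: h_cont.
Qed.

(** A bounded functional composed with a bounded operator is again a bounded functional. *)
Lemma bounded_linear_weak_continuous (R : realType) (X Z : normedModType R)
    (A : {linear X -> Z}) : bounded_near A (nbhs 0) ->
  continuous (A : weak X -> weak Z).
Proof.
move=> /bounded_linear_continuous A_cont; apply/continuous_weakP => -[f f_cont].
pose fA : {linear X -> R^o} := f \o A.
have fA_cont : continuous fA.
  by move=> x; apply: continuous_comp; [exact: A_cont|exact: f_cont].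
exact: (@dual_weak_continuous R X (exist _ fA fA_cont)).
Qed.

Lemma weak_translation_continuous (R : realType) (X : normedModType R) (b : X) :
  continuous ((fun x => x + b) : weak X -> weak X).
Proof.
apply/continuous_weakP => f x.
rewrite (_ : sval f \o _ = fun z => sval f z + sval f b); last first.
  by apply/funext => z /=; rewrite raddfD.
apply: continuousD; last exact: cst_continuous.
exact: (@dual_weak_continuous R X f x).
Qed.

(** * Weak lower semicontinuity of the network regularizer *)

Section network.
Context {R : realType} {X : completeNormedModType R} (N : network X).
Hypothesis A1 : conditionA1 N.

(** Each layer composes a bounded linear map, a translation and an activation, all weakly
    continuous. The bound on [l] reflects that [conditionA1] constrains only the layers below
    [depth N]. *)
Lemma feature_weak_continuous l : (l <= depth N)%N ->
  continuous (feature N l : weak X -> weak (layer_space X (hidden N) l)).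
Proof.
case: A1 => weight_bnd act_cont _.
elim: l => [_ x|l IHl ld x]; first exact: cvg_id.
have w_cont : continuous
    (weight N l : weak (layer_space X (hidden N) l) -> weak (Defs.half N l)).
  by apply: bounded_linear_weak_continuous; exact: weight_bnd.
have := cvg_comp _ _ (IHl (ltnW ld) x) (w_cont (feature N l x)).
move=> /cvg_comp -/(_ _ _ _ (weak_translation_continuous _ _ (bias N l) _)).
move=> /cvg_comp -/(_ _ _ _ (act_cont l ld _)).
exact.
Qed.

Lemma regularizer_weak_lsc :
  lower_semicontinuous (regularizer N : weak X -> \bar R).
Proof.
case: A1 => _ _ psi_lsc x a /psi_lsc[V nV Va].
exists (feature N (depth N) @^-1` V) => [|z Vz]; last exact: Va.
exact: feature_weak_continuous nV.
Qed.

End network.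

(** * Weak compactness of balls, via ultrafilters *)

Section compactness.
Context {R : realType} {X : hilbertType R}.

Lemma dualP (f : dual X) : exists x, forall v, sval f v = inner x v.
Proof.
case: f => f /= /linear_bounded_continuous.
move=> /linear_boundedP/pinfty_ex_gt0[r _ fr].
by apply: (@Riesz_representation _ _ f r); [exact: linearP|exact: fr].
Qed.

Lemma inner_weak_continuous (v : X) :
  continuous (inner v : weak X -> R^o).
Proof.
pose f : {linear X -> R^o} := inner v.
have f_cont : continuous f.
  apply/linear_bounded_continuous/bounded_funP => r.
  exists (`|v| * r) => x xr.
  by rewrite (le_trans (Cauchy_Schwarz v x))// ler_wpM2l.
exact: (@dual_weak_continuous R X (exist _ f f_cont)).
Qed.

Lemma bounded_ultra_cvg (T : Type) (U : set_system T) (f : T -> R) (r : R) :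
  UltraFilter U -> U [set x | `|f x| <= r] ->
  exists a : R, f x @[x --> U] --> a.
Proof.
move=> UU Ur.
have Ufr : U [set x | f x \in `[- r, r]].
  by apply: filterS Ur => x; rewrite /= ler_norml in_itv.
have [a [_ fUa]] := @segment_compact R (- r) r (f @ U) _ Ufr.
exists a => B aB.
(* An ultrafilter converges to its cluster points: otherwise the complement of the neighbourhood [B]
   would also have to meet [B]. *)
have [//|UBC] := in_ultra_setVsetC (f @^-1` B) UU.
by have [b [/= ? ?]] := fUa (~` B) B UBC aB.
Qed.

(* The limits of [inner x v] along [U] form a bounded linear functional of [v],
   whose Riesz representative is the weak limit. *)
Lemma bounded_ultra_cvg_weak (U : set_system X) (r : R) : UltraFilter U ->
  U [set x | `|x| <= r] -> exists x : weak X, U --> x.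
Proof.
move=> UU Ur.
have UP : ProperFilter U by exact: ultra_proper.
have UF : Filter U by exact: filter_filter.
have cvgU v : exists a : R, inner x v @[x --> U] --> a.
  apply: (@bounded_ultra_cvg _ _ _ (r * `|v|)).
  apply: filterS Ur => x /= xr.
  by rewrite (le_trans (Cauchy_Schwarz x v))// ler_wpM2r.
have [l Ul] := choice cvgU.
have [x0 lx0] : exists x0, forall v, l v = inner x0 v.
  apply: (@Riesz_representation _ _ l r) => [a u v|v].
    rewrite -(cvg_lim _ (Ul (a *: u + v)))//; apply: cvg_lim => //.
    under eq_fun do rewrite innerDr innerZr.
    by apply: cvgD; [apply: cvgMr; exact: Ul|exact: Ul].
  apply: (ler_cvg_to (cvg_norm (Ul v)) (cvg_cst (r * `|v|))).
  apply: filterS Ur => x /= xr.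
  by rewrite (le_trans (Cauchy_Schwarz x v))// ler_wpM2r.
exists x0; apply/cvg_weakP => f; have [w fw] := dualP f.
rewrite fw innerC -lx0.
by under eq_fun do rewrite fw innerC; exact: Ul.
Qed.

End compactness.

(** Otherwise some ultrafilter on the sublevel set has residuals tending to 0. Coercivity bounds it,
    so it has a weak limit, which lies in the fibre over [y]; lower semicontinuity then contradicts
    [Rf > s] there. *)
Lemma residual_bounded_below (R : realType) (X Y : hilbertType R) (F : X -> Y)
    (Fadj : Y -> X) (Rf : X -> \bar R) (y : Y) (s : R) :
  adjoint F Fadj -> lower_semicontinuous (Rf : weak X -> \bar R) ->
  conditionA3 Rf -> (forall x, F x = y -> (s%:E < Rf x)%E) ->
  exists2 c : R, 0 < c & forall x, (Rf x <= s%:E)%E -> c <= `|F x - y|.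
Proof.
move=> Fadj_P Rf_lsc Rf_coercive Rf_gt; apply: contrapT => no_bound.
(* The absence of a lower bound [c] is what makes this filter proper. *)
pose G := filter_from [set c : R | 0 < c]
  (fun c => [set x | (Rf x <= s%:E)%E /\ `|F x - y| < c]).
have GF : ProperFilter G.
  apply: filter_from_proper => [|c c0].
    apply: filter_from_filter; first by exists 1; rewrite /= ltr01.
    move=> i j i0 j0; exists (Num.min i j); first by rewrite /= lt_min i0.
    by move=> x [xs]; rewrite lt_min => /andP[xi xj].
  apply/set0P/eqP => S0; apply: no_bound; exists c => // x xs.
  rewrite leNgt; apply/negP => xc.
  by have : set0 x by rewrite -S0.
have [U [UU GU]] := ultraFilterLemma GF.
have UP : ProperFilter U by exact: ultra_proper.
have UF : Filter U by exact: filter_filter.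
have Us : U [set x | (Rf x <= s%:E)%E].
  by apply: GU; exists 1 => [|x []//]; rewrite /= ltr01.
have [r r_bnd] := Rf_coercive s.
have [x Ux] : exists x : weak X, U --> x.
  apply: (bounded_ultra_cvg_weak _ r) => //.
  apply: filterS Us => x /= xs; rewrite leNgt; apply/negP => /r_bnd.
  by rewrite ltNge xs.
have Fxy : F x = y.
  (* The pairing of [F z] with [F x - y] has two limits: one by weak convergence, through the
     adjoint, and one by norm convergence of [F z] to [y]. Their difference is [|F x - y| ^+ 2]. *)
  have UFx : inner (F z) (F x - y) @[z --> U] --> inner (F x) (F x - y).
    rewrite Fadj_P innerC.
    under eq_fun do rewrite Fadj_P innerC.
    exact: (cvg_comp _ _ Ux (inner_weak_continuous (Fadj (F x - y)) x)).
  have UFy : inner (F z) (F x - y) @[z --> U] --> inner y (F x - y).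
    apply/cvgrPdist_le => e e0.
    have n0 : 0 < `|F x - y| + 1 by rewrite ltr_wpDl.
    have : U [set z | (Rf z <= s%:E)%E /\ `|F z - y| < e / (`|F x - y| + 1)].
      by apply: GU; exists (e / (`|F x - y| + 1)) => //=; rewrite divr_gt0.
    apply: filterS => z [_ zy].
    rewrite -innerNl -innerDl (le_trans (Cauchy_Schwarz _ _))// distrC.
    rewrite (@le_trans _ _ (e / (`|F x - y| + 1) * (`|F x - y| + 1)))//.
      by apply: ler_pM => //; [exact: ltW|rewrite lerDl].
    by rewrite divfK// gt_eqF.
  apply/eqP; rewrite -subr_eq0 -normr_eq0 -sqrf_eq0.
  rewrite -inner_normE innerDl innerNl.
  have -> : inner (F x) (F x - y) = inner y (F x - y).
    exact: (norm_cvg_unique UFx UFy).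
  by rewrite subrr.
have [V Vx Vs] := Rf_lsc x s (Rf_gt x Fxy).
have [z [zs /Vs]] := filter_ex (filterI Us (Ux V Vx)).
by rewrite ltNge zs.
Qed.

(** * The conjugate function and Young's inequality *)

Section phi_conj.
Context {R : realType} (C : R).
Hypothesis C_gt0 : 0 < C.

(** Completing the square in [t]. *)
Lemma phi_conj_ubound s t : s * t - t ^+ 2 / C ^+ 2 <= C ^+ 2 * s ^+ 2 / 4.
Proof.
have -> : s * t - t ^+ 2 / C ^+ 2
    = C ^+ 2 * s ^+ 2 / 4 - (t / C - C * s / 2) ^+ 2.
  by field; rewrite gt_eqF.
by rewrite gerBl sqr_ge0.
Qed.

Lemma phi_conj_ge s t : 0 <= t -> s * t - t ^+ 2 / C ^+ 2 <= phi_conj C s.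
Proof.
move=> t0; apply: ub_le_sup; last by exists t.
by exists (C ^+ 2 * s ^+ 2 / 4) => _ [u _ <-]; exact: phi_conj_ubound.
Qed.

Lemma phi_conj_le s : phi_conj C s <= C ^+ 2 * s ^+ 2 / 4.
Proof.
apply: ge_sup; first by exists (s * 0 - 0 ^+ 2 / C ^+ 2), 0 => //=.
by move=> _ [u _ <-]; exact: phi_conj_ubound.
Qed.

(* Splitting [p] by subadditivity of the square root, the part of [C * p]
   coming from [q] is absorbed by [- q ^+ 2 / a] through Young's inequality for
   [phi] at [t = C * sqrt tau * q]. *)
Lemma young_estimate (tau a d p q : R) : 0 < tau -> 0 < a -> 0 <= d ->
  0 <= p -> 0 <= q -> p ^+ 2 <= tau * q ^+ 2 + tau * d ->
  (d - q ^+ 2) / a + C * p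
    <= d / a + phi C (tau * d) + phi_conj C (tau * a) / (tau * a).
Proof.
move=> tau0 a0 d0 p0 q0 pq.
have s0 := sqrtr_ge0 tau; have sd0 := sqrtr_ge0 (tau * d).
have stau : Num.sqrt tau ^+ 2 = tau by rewrite sqr_sqrtr ?ltW.
have sdtau : Num.sqrt (tau * d) ^+ 2 = tau * d.
  by rewrite sqr_sqrtr// mulr_ge0// ltW.
have p_le : p <= Num.sqrt tau * q + Num.sqrt (tau * d).
  rewrite -(@ler_pXn2r _ 2)// ?nnegrE ?addr_ge0 ?mulr_ge0//.
  rewrite (le_trans pq)// sqrrD exprMn stau sdtau.
  by rewrite -addrA lerD2l lerDr mulrn_wge0// !mulr_ge0.
have t0 : 0 <= C * Num.sqrt tau * q by rewrite !mulr_ge0// ltW.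
have ta0 : 0 < tau * a by rewrite mulr_gt0.
have conj_ge := phi_conj_ge (tau * a) _ t0.
have young : C * Num.sqrt tau * q - q ^+ 2 / a
    <= phi_conj C (tau * a) / (tau * a).
  rewrite ler_pdivlMr// (le_trans _ conj_ge)// le_eqVlt; apply/orP; left.
  apply/eqP; rewrite !exprMn stau; field.
  by rewrite !gt_eqF.
have := ler_wpM2l (ltW C_gt0) p_le.
rewrite /phi mulrDr mulrBl mulrA; lra.
Qed.

End phi_conj.

(** * Bregman bound and convergence rates *)

Lemma gateaux_differentiable_fin_num (R : realType) (X : normedModType R)
    (Rf : X -> \bar R) (x : X) :
  gateaux_differentiable Rf -> Rf x \is a fin_num.
Proof.
move=> /(_ x)[l /(_ 0)[/nbhs_singleton + _]].
by rewrite scaler0 addr0.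
Qed.

Local Open Scope ereal_scope.

Theorem proposition3p3 (R : realType) (X Y : hilbertType R)
  (F : {linear X -> Y}) (F_bounded : bounded_near F (nbhs 0%R))
  (Fadj : Y -> X) (F_adjoint : adjoint F Fadj)
  (N : network X) (y : Y) (xp : X)
  (xp_min : minimizing_solution F (regularizer N) y xp)
  (R_diff : gateaux_differentiable (regularizer N))
  (g : X) (g_grad : gateaux_gradient (regularizer N) xp g)
  (g_range : range Fadj g)
  (gamma eps : R) (gamma_gt0 : (0 < gamma)%R) (eps_gt0 : (0 < eps)%R)
  (R_lower : forall x : X, `|regularizer N x - regularizer N xp| < eps%:E ->
     regularizer N xp - regularizer N x <= (gamma * `|F x - F xp|)%:E) :
  exists C : R, [/\ (0 < C)%R,
    forall x : X, `|regularizer N x - regularizer N xp| < eps%:E ->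
      bregman (regularizer N) g x xp <=
        regularizer N x - regularizer N xp + (C * `|F x - F xp|)%:E &
    forall tau : R,
      conditionA1 N -> conditionA2 F (@sqdist R Y) tau ->
      conditionA3 (regularizer N) ->
      (exists2 eta : R, (0 < eta)%R &
         forall alpha delta : R,
           (0 < alpha < eta)%R -> (0 < delta < eta)%R ->
         forall yd : Y, (`|y - yd| ^+ 2 <= delta)%R ->
         forall x : X, argmin setT (tikhonov F (regularizer N) alpha yd) x ->
           bregman (regularizer N) g x xp <=
             (delta / alpha + phi C (tau * delta)
              + phi_conj C (tau * alpha) / (tau * alpha))%:E)
      /\
      (forall (alpha : R -> R) (y_ : R -> Y) (x_ : R -> X),
         same_order alpha (fun delta => delta / phi C (tau * delta))%R ->
         (\forall delta \near (0%R : R)^'+, (`|y - y_ delta| ^+ 2 <= delta)%R) ->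
         (\forall delta \near (0%R : R)^'+,
            argmin setT (tikhonov F (regularizer N) (alpha delta) (y_ delta))
              (x_ delta)) ->
         exists2 K : R, (0 < K)%R &
           \forall delta \near (0%R : R)^'+,
             bregman (regularizer N) g (x_ delta) xp
               <= (K * phi C (tau * delta))%:E)].
Proof.
have R_fin x : regularizer N x \is a fin_num.
  exact: gateaux_differentiable_fin_num.
have R_ge0 x : 0 <= regularizer N x by exact: psi_ge0.
pose rho x : R := fine (regularizer N x).
have rhoE x : regularizer N x = (rho x)%:E by rewrite fineK.
have rho_ge0 x : (0 <= rho x)%R by rewrite -lee_fin -rhoE.
case: xp_min => /= Fxp xp_le.
case: g_range => w _ gE.
(* The term [2 * gamma] pays for replacing a negative [rho x - rho xp] by its absolute value, and
   [|w|] for the gradient term. *)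
pose C : R := (2 * gamma + `|w|)%R.
have C_gt0 : (0 < C)%R by rewrite ltr_pwDl// mulr_gt0.
have bregman_le x : (rho xp - rho x <= gamma * `|F x - F xp|)%R ->
    bregman (regularizer N) g x xp <=
    (rho x - rho xp + C * `|F x - F xp|)%:E.
  move=> rho_lower; rewrite /bregman !rhoE -!EFinB abse_EFin lee_fin.
  have gx : (`|inner g (x - xp)| <= `|F x - F xp| * `|w|)%R.
    by rewrite -gE innerC -F_adjoint raddfB Cauchy_Schwarz.
  rewrite (le_trans (ler_normB _ _))// /C.
  have p0 : (0 <= gamma * `|F x - F xp|)%R by rewrite mulr_ge0// ltW.
  by case: (ger0P (rho x - rho xp)%R) => _; lra.
have rho_lower_near x : (`|rho x - rho xp| < eps)%R ->
    (rho xp - rho x <= gamma * `|F x - F xp|)%R.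
  move=> xe; rewrite -lee_fin EFinB -!rhoE R_lower//.
  by rewrite !rhoE -EFinB abse_EFin lte_fin.
exists C; split => // [x xe|tau A1 A2 A3].
  rewrite !rhoE -EFinB -EFinD; apply/bregman_le/rho_lower_near.
  by rewrite -lte_fin -abse_EFin EFinB -!rhoE.
case: A2 => tau_ge1 quasi_triangle _ _ _.
have tau_gt0 : (0 < tau)%R by rewrite (lt_le_trans _ tau_ge1).
(* The level [rho xp - eps] lies strictly below all values on the fibre, since [xp] is minimizing
   there. *)
have [c c_gt0 c_le] : exists2 c : R, (0 < c)%R &
    forall x, regularizer N x <= (rho xp - eps)%:E -> (c <= `|F x - y|)%R.
  apply: (residual_bounded_below _ _ _ _ Fadj) => //.
    exact: regularizer_weak_lsc.
  move=> x Fxy; rewrite (@lt_le_trans _ _ (rho xp)%:E)//.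
    by rewrite lte_fin gtrBl.
  by rewrite -rhoE xp_le.
have estimate : exists2 eta : R, (0 < eta)%R &
    forall alpha delta : R, (0 < alpha < eta)%R -> (0 < delta < eta)%R ->
    forall yd : Y, (`|y - yd| ^+ 2 <= delta)%R ->
    forall x : X, argmin setT (tikhonov F (regularizer N) alpha yd) x ->
      bregman (regularizer N) g x xp <=
        (delta / alpha + phi C (tau * delta)
         + phi_conj C (tau * alpha) / (tau * alpha))%:E.
  have rho2_gt0 : (0 < 2 + rho xp)%R by rewrite ltr_pwDl.
  (* Comparing a minimizer [x] with [xp] and using the quasi-triangle inequality gives [|F x - y| ^+
     2 <= tau * (2 * delta + alpha * rho xp)]; this [eta] makes the right side less than
     [c ^+ 2]. *)
  pose eta : R := (c ^+ 2 / tau / (2 + rho xp))%R.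
  have etaE : (eta * (2 + rho xp) = c ^+ 2 / tau)%R by rewrite divfK// gt_eqF.
  exists eta; first by rewrite !divr_gt0// exprn_gt0.
  move=> alpha delta /andP[alpha0 alpha_eta] /andP[delta0 delta_eta] yd yd_le x.
  move=> [_ /(_ xp I)].
  rewrite /tikhonov !rhoE -!EFinM -!EFinD lee_fin Fxp => x_min.
  have := quasi_triangle (F x) y yd.
  rewrite /sqdist -!EFinM -EFinD lee_fin (distrC yd) => Fxy_le.
  have q_le : (`|F x - yd| ^+ 2 + alpha * rho x
      <= delta + alpha * rho xp)%R by lra.
  have p_le : (`|F x - y| ^+ 2 <= tau * `|F x - yd| ^+ 2 + tau * delta)%R.
    by rewrite (le_trans Fxy_le)// lerD2l ler_pM2l.
  have p_lt : (`|F x - y| < c)%R.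
    rewrite -(@ltr_pXn2r _ 2)// ?nnegrE ?(ltW c_gt0)//.
    rewrite (le_lt_trans p_le)// -mulrDr mulrC -ltr_pdivlMr// -etaE.
    have := mulr_ge0 (ltW alpha0) (rho_ge0 x).
    by have := ler_wpM2r (rho_ge0 xp) (ltW alpha_eta); lra.
  (* Trivial if [rho xp <= rho x]. Otherwise [rho x] is within [eps] of [rho xp], because a larger
     drop would force a residual of at least [c]. *)
  have lower : (rho xp - rho x <= gamma * `|F x - F xp|)%R.
    have [rho_le|rho_gt] := lerP (rho xp) (rho x).
      by rewrite (@le_trans _ _ 0)%R// ?subr_le0// mulr_ge0// ltW.
    apply: rho_lower_near; rewrite ltr0_norm ?subr_lt0// opprB ltrBlDl -ltrBlDr.
    rewrite ltNge; apply/negP => rho_eps.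
    have := c_le x; rewrite rhoE lee_fin => /(_ rho_eps).
    by rewrite leNgt p_lt.
  apply: (le_trans (bregman_le _ lower)); rewrite lee_fin Fxp.
  apply: le_trans (young_estimate C C_gt0 _ _ _ _ _ tau_gt0 alpha0
    (ltW delta0) _ _ p_le) => //.
  rewrite lerD2r ler_pdivlMr//; lra.
split=> // alpha y_ x_ [c1 [c2 [c1_gt0 c2_gt0 alpha_order]]] y_near x_min.
case: estimate => eta eta_gt0 eta_P.
(* One summand for each term of the estimate: [alpha >= c1 * delta / phi] controls [delta / alpha],
   and [alpha <= c2 * delta / phi] controls the conjugate term, which is at most
   [C ^+ 2 * tau * alpha / 4]. *)
exists (c1^-1 + 1 + c2 / 4)%R.
  by rewrite !addr_gt0 ?invr_gt0// divr_gt0.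
(* With [s = sqrt (tau * delta)], the rate [delta / phi] is [s / (C * tau)], so [s < k] forces
   [alpha < eta]; in terms of [delta] this reads [delta < k ^+ 2 / tau]. *)
pose k : R := (eta * (C * tau) / c2)%R.
have k_gt0 : (0 < k)%R by rewrite divr_gt0// !mulr_gt0.
have k2_gt0 : (0 < k ^+ 2 / tau)%R by rewrite divr_gt0// exprn_gt0.
near=> delta.
have delta_gt0 : (0 < delta)%R by [].
set s := Num.sqrt (tau * delta).
have s_gt0 : (0 < s)%R by rewrite sqrtr_gt0 mulr_gt0.
have s2 : (s ^+ 2 = tau * delta)%R by rewrite sqr_sqrtr// mulr_ge0 ?ltW.
have deltaE : (delta = s ^+ 2 / tau)%R by rewrite s2 mulrC mulKf ?gt_eqF.
have rateE : (delta / phi C (tau * delta) = s / (C * tau))%R.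
  by rewrite /phi -/s {1}deltaE; field; rewrite !gt_eqF.
have /andP[] : (c1 * (delta / phi C (tau * delta)) <= alpha delta
    <= c2 * (delta / phi C (tau * delta)))%R by near: delta.
rewrite rateE => alpha_ge alpha_le.
have alpha_gt0 : (0 < alpha delta)%R.
  by rewrite (lt_le_trans _ alpha_ge)// mulr_gt0// divr_gt0// mulr_gt0.
have s_lt : (c2 * (s / (C * tau)) < eta)%R.
  have s_lt_k : (s < k)%R.
    rewrite -(@ltr_pXn2r _ 2)// ?nnegrE ?(ltW s_gt0) ?(ltW k_gt0)//.
    rewrite s2 mulrC -ltr_pdivlMr//.
  rewrite -ltr_pdivlMl// ltr_pdivrMr ?mulr_gt0//.
  by have -> : (c2^-1 * eta * (C * tau) = k)%R by rewrite /k; ring.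
apply: le_trans (eta_P (alpha delta) delta _ _ (y_ delta) _ (x_ delta) _) _.
- by rewrite alpha_gt0 (le_lt_trans alpha_le).
- by rewrite delta_gt0/=; near: delta; exact: nbhs_right_lt.
- by near: delta.
- by near: delta.
rewrite lee_fin -/s /phi -/s.
have -> : ((c1^-1 + 1 + c2 / 4) * (C * s)
    = C * s / c1 + C * s + C * (c2 * s / 4))%R.
  by field; rewrite gt_eqF.
have ta_gt0 : (0 < tau * alpha delta)%R by rewrite mulr_gt0.
apply: lerD; first apply: lerD => //.
  have dE : (C * s / c1 * (c1 * (s / (C * tau))) = delta)%R.
    by rewrite [RHS]deltaE; field; rewrite !gt_eqF.
  by rewrite ler_pdivrMr// -[leLHS]dE ler_wpM2l// divr_ge0 ?mulr_ge0// ltW.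
rewrite ler_pdivrMr// (le_trans (phi_conj_le C C_gt0 _))//.
have -> : (C ^+ 2 * (tau * alpha delta) ^+ 2 / 4 =
  C ^+ 2 * tau / 4 * alpha delta * (tau * alpha delta))%R by field.
rewrite ler_wpM2r ?(ltW ta_gt0)//.
have -> : (C * (c2 * s / 4) = C ^+ 2 * tau / 4 * (c2 * (s / (C * tau))))%R.
  by field; rewrite !gt_eqF.
by rewrite ler_wpM2l// divr_ge0// mulr_ge0 ?sqr_ge0// ltW.
Unshelve. all: by end_near. Qed.
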